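(* Let $\mathbb{T}$ be a time scale with $a,b\in\mathbb{T}$, $a<b$, and let $f$ and $g$ be (real-valued) $\nabla$-differentiable functions on $]a,b[$. Suppose that either $g^\nabla>0$ everywhere on $]\sigma(a),b[$ or $g^\nabla<0$ everywhere on $]\sigma(a),b[$. \begin{enumerate} \item If $\dfrac{f^\nabla}{g^\nabla}$ is increasing (resp. decreasing) on $]\sigma(a),b[$ and $f(a^+)$ and $g(a^+)$ exist (finite), then the function $$x\mapsto\frac{f(x)-f(a^+)}{g(x)-g(a^+)}$$ is also increasing (resp. decreasing) on $]\sigma(a),b[$. \item If $\dfrac{f^\nabla}{g^\nabla}$ is increasing (resp. decreasing) on $]\sigma(a),b[$ and $f(b^-)$ and $g(b^-)$ exist (finite), then the function $$x\mapsto\frac{f(x)-f(b^-)}{g(x)-g(b^-)}$$ is also increasing (resp. decreasing) on $]\sigma(a),b[$. \end{enumerate}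
   Context: A time scale $\mathbb{T}$ is a nonempty closed subset of $\mathbb{R}$. The forward and backward jump operators are $\sigma(t)=\inf\{s\in\mathbb{T}:s>t\}$ and $\rho(t)=\sup\{s\in\mathbb{T}:s<t\}$ (with $\inf\emptyset=\sup\mathbb{T}$, $\sup\emptyset=\inf\mathbb{T}$). A function $f$ is $\nabla$-differentiable at $t$ with nabla derivative $f^\nabla(t)\in\mathbb{R}$ if for every $\varepsilon>0$ there is a neighbourhood $U$ of $t$ in $\mathbb{T}$ such that $|f(\rho(t))-f(s)-f^\nabla(t)(\rho(t)-s)|\le\varepsilon|\rho(t)-s|$ for all $s\in U$. All intervals are time scale intervals, i.e. intersections of real intervals with $\mathbb{T}$; $]c,d[$ denotes the open interval $\{t\in\mathbb{T}:c<t<d\}$. The notation $f(a^+)$ means $\lim_{x\to a^+}f(x)$ and $f(b^-)$ means $\lim_{x\to b^-}f(x)$. ''Increasing'' and ''decreasing'' are meant in the strict sense. *)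

(* Defs.v *)
From HB Require Import structures.
From mathcomp Require Import all_boot all_order all_algebra.
From mathcomp Require Import all_classical all_reals all_analysis.
Set Implicit Arguments.
Unset Strict Implicit.
Unset Printing Implicit Defensive.
Import Order.TTheory GRing.Theory Num.Theory.
Import numFieldNormedType.Exports.
Local Open Scope classical_set_scope.
Local Open Scope ring_scope.

Definition time_scale (R : realType) (T : set R) : Prop :=
  T !=set0 /\ closed T.

(* The library sets [inf set0 = sup set0 = 0], so the conventions
   [inf set0 = sup T] and [sup set0 = inf T] have to be imposed by hand. *)
Definition sigma (R : realType) (T : set R) (t : R) : R :=
  if [set s | T s /\ t < s] == set0 then sup T
  else inf [set s | T s /\ t < s].

Definition rho (R : realType) (T : set R) (t : R) : R :=
  if [set s | T s /\ s < t] == set0 then inf T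
  else sup [set s | T s /\ s < t].

Definition ts_oo (R : realType) (T : set R) (c d : R) : set R :=
  [set t | T t /\ c < t < d].

(* Functions on a time scale are represented by total functions on [R]; only
   their values at points of [T] are used. *)
Definition is_nabla (R : realType) (T : set R) (f : R -> R) (t d : R) : Prop :=
  forall e : R, 0 < e ->
    \forall s \near within T (nbhs t),
      `|f (rho T t) - f s - d * (rho T t - s)| <= e * `|rho T t - s|.

Definition nabla_differentiable (R : realType) (T : set R) (f : R -> R)
    (t : R) : Prop :=
  exists d, is_nabla T f t d.

(* The nabla derivative; the value 0 is junk, taken only where [f] is not
   differentiable. *)
Definition nabla (R : realType) (T : set R) (f : R -> R) (t : R) : R :=
  xget 0 [set d | is_nabla T f t d].

(* [right_limit T f a l] means f(a^+) = l.  At a right-dense point this is the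
   one-sided limit along T.  At a right-scattered point no point of T tends
   to [a] from the right, and the filter would be trivial; f(a^+) is then the
   value at the first point of T after [a], i.e. the limit of f(x) as x
   decreases through the points of T beyond [a].  Similarly on the left. *)
Definition right_limit (R : realType) (T : set R) (f : R -> R) (a l : R) : Prop :=
  if sigma T a == a then f x @[x --> within T (a^'+)] --> l
  else f (sigma T a) = l.

Definition left_limit (R : realType) (T : set R) (f : R -> R) (b l : R) : Prop :=
  if rho T b == b then f x @[x --> within T (b^'-)] --> l
  else f (rho T b) = l.

Definition increasing_on (R : realType) (D : set R) (h : R -> R) : Prop :=
  forall x y, D x -> D y -> x < y -> h x < h y.

Definition decreasing_on (R : realType) (D : set R) (h : R -> R) : Prop :=
  forall x y, D x -> D y -> x < y -> h y < h x.

(* Division is total in the library ([x / 0 = 0]), so that a quotient is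
   genuinely defined on [D] is a separate claim. *)
Definition quotient_defined_on (R : realType) (D : set R) (g : R -> R) (c : R)
    : Prop :=
  forall x, D x -> g x - c != 0.

(* Main.v *)
(* The differential inequalities "nabla h >= 0 on ]u,v] implies h u <= h v", and
   its strict version, are proved by taking the infimum of the points from which
   [h] loses at most [e] per unit of time up to [v], and then stepping left from
   it.  They play the role of Cauchy's mean value theorem: for x < y, applied to
   [f - k g] with [k] the value of the ratio of derivatives at the point shared
   by two adjacent intervals, they separate the slopes of [f] against [g] on the
   two intervals.  The slope over their union is a weighted mean of these two,
   hence lies strictly between them. *)
Require Import Defs.
From HB Require Import structures.
From mathcomp Require Import all_boot all_order all_algebra.
From mathcomp Require Import all_classical all_reals all_analysis.
From mathcomp Require Import ring lra.
Set Implicit Arguments.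
Unset Strict Implicit.
Unset Printing Implicit Defensive.
Import Order.TTheory GRing.Theory Num.Theory.
Import numFieldNormedType.Exports.
Local Open Scope classical_set_scope.
Local Open Scope ring_scope.

(** * Local consequences of nabla differentiability *)

(** The neighbourhood in the definition contains [t] itself, so the estimate can be read at [s = t];
    there the error is below any multiple of the fixed number [c]. *)
Lemma is_nabla_rho (R : realType) (T : set R) (h : R -> R) (t d : R) :
  T t -> is_nabla T h t d -> h (rho T t) - h t = d * (rho T t - t).
Proof.
move=> Tt ht; apply/eqP; rewrite -subr_eq0 -normr_le0; apply/ler_addgt0Pr => e e0.
rewrite add0r; set c := `|rho T t - t|.
(* At a left-dense point [c = 0], so [e] is divided by [c + 1]. *)
have c1 : 0 < c + 1 by rewrite ltr_wpDl // normr_ge0.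
have /ht : 0 < e / (c + 1) by rewrite divr_gt0.
rewrite near_withinE => /nbhs_singleton /(_ Tt) /le_trans; apply.
by rewrite mulrAC ler_pdivrMr // ler_pM2l // lerDl.
Qed.

Lemma is_nabla_cvg (R : realType) (T : set R) (h : R -> R) (t d : R) :
  T t -> is_nabla T h t d -> h x @[x --> within T (nbhs t)] --> h t.
Proof.
move=> Tt ht; apply/cvgrPdist_le => e e0.
have hr := is_nabla_rho Tt ht.
set c := `|rho T t - t|.
have c0 : 0 <= c by exact: normr_ge0.
(* [k] and [m] give each of the two terms of [h t - h s] below at most [e / 2], using
   [|rho T t - s| <= c + 1 <= 2 * c + 1]. *)
pose k := e / 2 / (2 * c + 1).
have k0 : 0 < k by rewrite !divr_gt0 // ltr_wpDl // mulr_ge0.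
have kE : k * (2 * c + 1) = e / 2.
  by rewrite /k mulfVK // gt_eqF // ltr_wpDl // mulr_ge0.
have := ht _ k0; rewrite !near_withinE => hk.
pose m := e / 2 / (`|d| + 1).
have d1 : 0 < `|d| + 1 by rewrite ltr_wpDl.
have m0 : 0 < m by rewrite !divr_gt0.
have mE : m * (`|d| + 1) = e / 2 by rewrite /m mulfVK // gt_eqF.
near=> s => Ts.
have s1 : `|t - s| <= 1 by near: s; apply: (@cvgr_dist_le _ _ _ _ _ id t).
have sm : `|t - s| <= m by near: s; apply: (@cvgr_dist_le _ _ _ _ _ id t).
have hs : `|h (rho T t) - h s - d * (rho T t - s)| <= k * `|rho T t - s|.
  by move: Ts; near: s.
(* The exact increment between [rho T t] and [t] is subtracted from the estimate at [s]; this treats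
   scattered and dense points together. *)
have -> : h t - h s = (h (rho T t) - h s - d * (rho T t - s)) + d * (t - s).
  have -> : h t = h (rho T t) - d * (rho T t - t) by rewrite -hr; ring.
  ring.
apply: (le_trans (ler_normD _ _)); rewrite normrM.
have A1 : `|rho T t - s| <= c + 1.
  have -> : rho T t - s = (rho T t - t) + (t - s) by ring.
  by apply: (le_trans (ler_normD _ _)); rewrite lerD2l.
have A2 : k * `|rho T t - s| <= e / 2.
  by rewrite -kE ler_pM2l //; apply: (le_trans A1); rewrite lerD2r; lra.
have A3 : `|d| * `|t - s| <= e / 2.
  rewrite -mE mulrC; apply: ler_pM => //; lra.
lra.
Unshelve. all: by end_near. Qed.

(** * Jump operators and closedness *)

(** The point [u] of [T] below [t] excludes the empty-set branch of [rho]. A point of [T] above [t]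
    does the same for [sigma] in the lemmas that follow. *)
Lemma rho_bounds (R : realType) (T : set R) (u t : R) :
  T u -> u < t -> u <= rho T t <= t.
Proof.
move=> Tu ut; have Su : [set s | T s /\ s < t] u by [].
have S0 : [set s | T s /\ s < t] !=set0 by exists u.
have St : ubound [set s | T s /\ s < t] t by move=> s [_ /ltW].
rewrite /rho ifF; last by apply/eqP => S; rewrite S in Su.
by rewrite ub_le_sup ?ge_sup //; exists t.
Qed.

Lemma sigma_bounds (R : realType) (T : set R) (t v : R) :
  T v -> t < v -> t <= sigma T t <= v.
Proof.
move=> Tv tv; have Sv : [set s | T s /\ t < s] v by [].
have S0 : [set s | T s /\ t < s] !=set0 by exists v.
have St : lbound [set s | T s /\ t < s] t by move=> s [_ /ltW].
rewrite /sigma ifF; last by apply/eqP => S; rewrite S in Sv.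
by rewrite ge_inf ?lb_le_inf //; exists t.
Qed.

Lemma rho_approx (R : realType) (T : set R) (u t e : R) :
  T u -> u < t -> 0 < e -> exists s, [/\ T s, u <= s, s < t & rho T t - e < s].
Proof.
move=> Tu ut e0; have Su : [set s | T s /\ s < t] u by [].
have [s [Ts st] es] : exists2 s, [set s | T s /\ s < t] s & rho T t - e < s.
  rewrite /rho ifF; last by apply/eqP => S; rewrite S in Su.
  by apply: sup_adherent => //; split; [exists u | exists t => s [_ /ltW]].
(* If the adherent point falls below [u], then [u] lies between it and [t] and serves instead. *)
have [us|su] := leP u s; first by exists s.
by exists u; split => //; apply: lt_trans su.
Qed.

Lemma sigma_approx (R : realType) (T : set R) (t v e : R) :
  T v -> t < v -> 0 < e -> exists s, [/\ T s, s <= v, t < s & s < sigma T t + e].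
Proof.
move=> Tv tv e0; have Sv : [set s | T s /\ t < s] v by [].
have [s [Ts ts] es] : exists2 s, [set s | T s /\ t < s] s & s < sigma T t + e.
  rewrite /sigma ifF; last by apply/eqP => S; rewrite S in Sv.
  by apply: inf_adherent => //; split; [exists v | exists t => s [_ /ltW]].
have [sv|vs] := leP s v; first by exists s.
by exists v; split => //; apply: lt_trans es.
Qed.

Lemma closed_approx (R : realType) (T : set R) (x : R) : closed T ->
  (forall e, 0 < e -> exists2 s, T s & `|x - s| < e) -> T x.
Proof.
move=> cT xT; apply: cT => U /nbhs_ballP [e /= e0 eU].
by have [s Ts xs] := xT _ e0; exists s; split => //; apply: eU.
Qed.

Lemma rho_in (R : realType) (T : set R) (u t : R) :
  closed T -> T u -> u < t -> T (rho T t).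
Proof.
move=> cT Tu ut; apply: closed_approx => // e e0.
have [s [Ts us st es]] := rho_approx Tu ut e0; exists s => //.
have /andP[sr _] := rho_bounds Ts st.
by rewrite ger0_norm ?subr_ge0 // ltrBlDr -ltrBlDl.
Qed.

Lemma sigma_in (R : realType) (T : set R) (t v : R) :
  closed T -> T v -> t < v -> T (sigma T t).
Proof.
move=> cT Tv tv; apply: closed_approx => // e e0.
have [s [Ts sv ts es]] := sigma_approx Tv tv e0; exists s => //.
have /andP[_ sr] := sigma_bounds Ts ts.
by rewrite ler0_norm ?subr_le0 // opprB ltrBlDl.
Qed.

(* If [t] is left-scattered, [s] is [rho T t], where the increment is exactly
   [d * (t - s)]; otherwise [s] is close to [t]. *)
Lemma is_nabla_left_step (R : realType) (T : set R) (h : R -> R) (u t d e : R) :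
  closed T -> T u -> T t -> u < t -> is_nabla T h t d -> 0 < e ->
  exists s, [/\ T s, u <= s, s < t & (d - e) * (t - s) <= h t - h s].
Proof.
move=> cT Tu Tt ut ht e0; have /andP[ur rt] := rho_bounds Tu ut.
have [rlt|tr] := ltP (rho T t) t.
  exists (rho T t); split => //; first exact: rho_in ut.
  have -> : h t - h (rho T t) = d * (t - rho T t).
    by rewrite -opprB (is_nabla_rho Tt ht); ring.
  by rewrite ler_pM2r ?subr_gt0 // gerBl ltW.
have rE : rho T t = t by apply/eqP; rewrite eq_le rt.
have := ht _ e0; rewrite near_withinE rE => /nbhs_ballP [k /= k0 kh].
have [s [Ts us st ks]] := rho_approx Tu ut k0; exists s; split => //.
have ts0 : 0 <= t - s by rewrite subr_ge0 ltW.
have /kh /(_ Ts) : ball t k s.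
  by rewrite /ball /= ger0_norm //; move: ks; rewrite rE; lra.
rewrite (ger0_norm ts0) ler_norml => /andP[+ _].
by rewrite mulrBl; lra.
Qed.

(** * Monotonicity from the sign of the nabla derivative *)

(** Left steps start only from points above [u], so the sign is imposed on ]u,v]. This allows [u] to
    be [sigma T a], which lies outside the interval where signs are given. *)
Lemma nabla_nondecreasing (R : realType) (T : set R) (h d : R -> R) (u v : R) :
  closed T -> T u -> T v -> u <= v ->
  (forall t, T t -> u <= t <= v -> is_nabla T h t (d t)) ->
  (forall t, T t -> u < t <= v -> 0 <= d t) -> h u <= h v.
Proof.
move=> cT Tu Tv uv hd d0.
suff H e : 0 < e -> - e * (v - u) <= h v - h u.
  apply/ler_addgt0Pr => e e0.
  have vu1 : 0 < v - u + 1 by rewrite ltr_wpDl // subr_ge0.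
  have := H _ (divr_gt0 e0 vu1); rewrite -subr_ge0 mulNr opprK => H1.
  suff : e / (v - u + 1) * (v - u) <= e by lra.
  by rewrite mulrAC ler_pdivrMr // ler_pM2l // lerDl.
move=> e0.
pose S := [set t | [/\ T t, u <= t <= v & - e * (v - t) <= h v - h t]].
have Sv : S v by split; rewrite ?uv ?lexx // !subrr mulr0.
have lS : has_lbound S by exists u => t [_ /andP[]].
have iS : has_inf S by split; first exists v.
pose m := inf S.
have um : u <= m by apply: lb_le_inf => [|t [_ /andP[]]//]; exists v.
have mv : m <= v by exact: ge_inf.
have Tm : T m.
  apply: closed_approx => // k k0.
  have [s Ss sk] := inf_adherent k0 iS.
  have ms : m <= s by exact: ge_inf.
  case: Ss => Ts _ _; exists s => //.
  by rewrite ler0_norm ?subr_le0 // opprB ltrBlDl.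
(* Points of [S] approach [m] from the right, and continuity of [h] at [m] carries the inequality to
   the infimum. *)
have Sm : S m.
  split; rewrite ?um //; apply/ler_addgt0Pr => k k0.
  have /cvgrPdist_le /(_ _ k0) := is_nabla_cvg Tm (hd _ Tm (introT andP (conj um mv))).
  rewrite near_withinE => /nbhs_ballP [p /= p0 ph].
  have [s Ss sp] := inf_adherent p0 iS.
  have ms : m <= s by exact: ge_inf.
  case: Ss => Ts _ hs.
  have /ph /(_ Ts) : ball m p s.
    by rewrite /ball /= ler0_norm ?subr_le0 // opprB ltrBlDl.
  rewrite ler_norml => /andP[_ +].
  have : e * m <= e * s by rewrite ler_pM2l.
  move: hs; rewrite !mulNr !mulrBr; lra.
suff -> : u = m by case: Sm.
(* If [u < m], a left step from [m] with slack [e] loses at most [e] per unit of time, because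
   [0 <= d m]; it lands in [S] below its infimum. *)
apply/eqP; rewrite eq_le um leNgt; apply/negP => ltum.
have [s [Ts us sm hs]] := is_nabla_left_step cT Tu Tm ltum
  (hd _ Tm (introT andP (conj um mv))) e0.
have : S s.
  split; rewrite ?us ?(le_trans (ltW sm)) //.
  case: Sm => _ _.
  have : 0 <= d m * (m - s).
    by rewrite mulr_ge0 ?d0 ?ltum ?subr_ge0 // ltW.
  move: hs; rewrite mulrBl !mulNr !mulrBr; lra.
by move=> /(ge_inf lS); rewrite leNgt sm.
Qed.

(** Strictness comes from a single left step at [v], with slack [d v / 2]; the weak inequality
    covers what remains, from [u] to [s]. *)
Lemma nabla_increasing (R : realType) (T : set R) (h d : R -> R) (u v : R) :
  closed T -> T u -> T v -> u < v ->
  (forall t, T t -> u <= t <= v -> is_nabla T h t (d t)) ->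
  (forall t, T t -> u < t <= v -> 0 < d t) -> h u < h v.
Proof.
move=> cT Tu Tv uv hd d0.
have dv : 0 < d v by rewrite d0 ?uv /=.
have dv2 : 0 < d v / 2 by rewrite divr_gt0.
have [s [Ts us sv]] := is_nabla_left_step cT Tu Tv uv
  (hd _ Tv (introT andP (conj (ltW uv) (lexx v)))) dv2.
have : 0 < (d v - d v / 2) * (v - s) by rewrite mulr_gt0 ?subr_gt0 //; lra.
have : h u <= h s.
  apply: (@nabla_nondecreasing _ T _ d) => // t Tt /andP[ut ts].
    by apply: hd => //; rewrite ut (le_trans ts) // ltW.
  by rewrite ltW // d0 // ut (le_trans ts) // ltW.
lra.
Qed.

(** * Linear combinations of derivatives and of one-sided limits *)

Lemma is_nablaBZ (R : realType) (T : set R) (f g : R -> R) (k t df dg : R) :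
  is_nabla T f t df -> is_nabla T g t dg ->
  is_nabla T (fun x => f x - k * g x) t (df - k * dg).
Proof.
move=> hf hg e e0.
have k1 : 0 < `|k| + 1 by rewrite ltr_wpDl.
pose p := e / 2 / (`|k| + 1).
have p0 : 0 < p by rewrite !divr_gt0.
have pE : p * (`|k| + 1) = e / 2 by rewrite /p mulfVK // gt_eqF.
have e2 : 0 < e / 2 by rewrite divr_gt0.
apply: filterS2 (hf _ e2) (hg _ p0) => s.
move: (rho T t) => r hA hB.
have -> : f r - k * g r - (f s - k * g s) - (df - k * dg) * (r - s) =
  (f r - f s - df * (r - s)) - k * (g r - g s - dg * (r - s)) by ring.
apply: (le_trans (ler_normB _ _)); rewrite normrM.
have : `|k| * `|g r - g s - dg * (r - s)| <= e / 2 * `|r - s|.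
  apply: (le_trans (ler_wpM2l (normr_ge0 k) hB)).
  rewrite mulrA ler_wpM2r // -pE mulrC ler_pM2l //; lra.
move: hA; lra.
Qed.

Lemma is_nablaN (R : realType) (T : set R) (f : R -> R) (t df : R) :
  is_nabla T f t df -> is_nabla T (fun x => - f x) t (- df).
Proof.
move=> hf e /hf; apply: filterS => s; rewrite -normrN.
by congr (`|_| <= _); ring.
Qed.

Lemma right_limitBZ (R : realType) (T : set R) (f g : R -> R) (k a fa ga : R) :
  right_limit T f a fa -> right_limit T g a ga ->
  right_limit T (fun x => f x - k * g x) a (fa - k * ga).
Proof.
rewrite /right_limit; case: ifP => _ hf hg; last by rewrite hf hg.
by apply: cvgB => //; apply: cvgM => //; exact: cvg_cst.
Qed.

Lemma left_limitBZ (R : realType) (T : set R) (f g : R -> R) (k b fb gb : R) :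
  left_limit T f b fb -> left_limit T g b gb ->
  left_limit T (fun x => f x - k * g x) b (fb - k * gb).
Proof.
rewrite /left_limit; case: ifP => _ hf hg; last by rewrite hf hg.
by apply: cvgB => //; apply: cvgM => //; exact: cvg_cst.
Qed.

Lemma right_limitN (R : realType) (T : set R) (f : R -> R) (a l : R) :
  right_limit T f a l -> right_limit T (fun x => - f x) a (- l).
Proof. by rewrite /right_limit; case: ifP => _; [exact: cvgN | move->]. Qed.

Lemma left_limitN (R : realType) (T : set R) (f : R -> R) (b l : R) :
  left_limit T f b l -> left_limit T (fun x => - f x) b (- l).
Proof. by rewrite /left_limit; case: ifP => _; [exact: cvgN | move->]. Qed.

(** * Comparison of values with the limits at the endpoints *)

(** This unifies the two cases of [right_limit]: [s] is [sigma T a] if [a] is right-scattered, and a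
    point close to [a] otherwise. Since [sigma T a <= s], the sign hypotheses apply to all points of
    [T] in ]s,y]. *)
Lemma right_limit_approx (R : realType) (T : set R) (h : R -> R) (a l y e : R) :
  closed T -> right_limit T h a l -> T y -> a < y -> 0 < e ->
  exists s, [/\ T s, a < s <= y, sigma T a <= s & `|l - h s| < e].
Proof.
move=> cT hl Ty ay e0; have /andP[aS Sy] := sigma_bounds Ty ay.
move: hl; rewrite /right_limit; case: eqP => [sE|/eqP sa hl]; last first.
  exists (sigma T a); rewrite hl subrr normr0; split => //.
    exact: sigma_in ay.
  by rewrite Sy andbT lt_def sa.
move=> /cvgrPdist_lt /(_ _ e0); rewrite near_withinE near_withinE.
move=> /nbhs_ballP [p /= p0 ph].
have [s [Ts sy as_ sp]] := sigma_approx Ty ay p0.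
exists s; rewrite as_ sy sE ltW //; split => //; apply: ph => //.
by rewrite /ball /= ltr0_norm ?subr_lt0 // opprB ltrBlDl -sE.
Qed.

Lemma left_limit_approx (R : realType) (T : set R) (h : R -> R) (b l y e : R) :
  closed T -> left_limit T h b l -> T y -> y < b -> 0 < e ->
  exists s, [/\ T s, y <= s < b, s <= rho T b & `|l - h s| < e].
Proof.
move=> cT hl Ty yb e0; have /andP[yS Sb] := rho_bounds Ty yb.
move: hl; rewrite /left_limit; case: eqP => [sE|/eqP sb hl]; last first.
  exists (rho T b); rewrite hl subrr normr0; split => //.
    exact: rho_in yb.
  by rewrite yS lt_neqAle sb.
move=> /cvgrPdist_lt /(_ _ e0); rewrite near_withinE near_withinE.
move=> /nbhs_ballP [p /= p0 ph].
have [s [Ts ys sb sp]] := rho_approx Ty yb p0.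
exists s; rewrite ys sb sE ltW //; split => //; apply: ph => //.
by rewrite /ball /= gtr0_norm ?subr_gt0 // ltrBlDl -ltrBlDr -sE.
Qed.

Lemma right_limit_le (R : realType) (T : set R) (h d : R -> R) (a l y : R) :
  closed T -> right_limit T h a l -> T y -> a < y ->
  (forall t, T t -> a < t <= y -> is_nabla T h t (d t)) ->
  (forall t, T t -> sigma T a < t <= y -> 0 <= d t) -> l <= h y.
Proof.
move=> cT hl Ty ay hd d0; apply/ler_addgt0Pr => e e0.
have [s [Ts /andP[as_ sy] Ss]] := right_limit_approx cT hl Ty ay e0.
have : h s <= h y.
  apply: (@nabla_nondecreasing _ T _ d) => // t Tt /andP[st ty].
    by apply: hd => //; rewrite ty (lt_le_trans as_).
  by apply: d0 => //; rewrite ty (le_lt_trans Ss).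
rewrite ltr_norml => ? /andP[]; lra.
Qed.

(** An intermediate point [s] of [T] splits the inequality: weak from the limit to [s], strict from
    [s] to [y]. *)
Lemma right_limit_lt (R : realType) (T : set R) (h d : R -> R) (a l y : R) :
  closed T -> right_limit T h a l -> T y -> a < y -> sigma T a < y ->
  (forall t, T t -> a < t <= y -> is_nabla T h t (d t)) ->
  (forall t, T t -> sigma T a < t <= y -> 0 < d t) -> l < h y.
Proof.
move=> cT hl Ty ay Sy hd d0.
have [s [Ts as_ sy]] : exists s, [/\ T s, a < s & s < y].
  (* With radius [y - sigma T a], the point approximating [sigma T a] stays below [y]. *)
  have r0 : 0 < y - sigma T a by rewrite subr_gt0.
  have [s [Ts _ as_]] := sigma_approx Ty ay r0.
  by rewrite addrC subrK => sy; exists s.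
have /andP[_ Ss] := sigma_bounds Ts as_.
have : l <= h s.
  apply: (@right_limit_le _ T _ d a) => // t Tt /andP[st ty].
    by apply: hd => //; rewrite st (le_trans ty) // ltW.
  by rewrite ltW // d0 // st (le_trans ty) // ltW.
move=> /le_lt_trans; apply.
apply: (@nabla_increasing _ T _ d) => // t Tt /andP[st ty].
  by apply: hd => //; rewrite ty (lt_le_trans as_).
by apply: d0 => //; rewrite ty (le_lt_trans Ss).
Qed.

Lemma left_limit_ge (R : realType) (T : set R) (h d : R -> R) (b l y : R) :
  closed T -> left_limit T h b l -> T y -> y < b ->
  (forall t, T t -> y <= t < b -> is_nabla T h t (d t)) ->
  (forall t, T t -> y < t < b -> 0 <= d t) -> h y <= l.
Proof.
move=> cT hl Ty yb hd d0; apply/ler_addgt0Pr => e e0.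
have [s [Ts /andP[ys sb] Ss]] := left_limit_approx cT hl Ty yb e0.
have : h y <= h s.
  apply: (@nabla_nondecreasing _ T _ d) => // t Tt /andP[yt ts].
    by apply: hd => //; rewrite yt (le_lt_trans ts).
  by apply: d0 => //; rewrite yt (le_lt_trans ts).
rewrite ltr_norml => ? /andP[]; lra.
Qed.

(** The condition [y != rho T b] provides a point of [T] strictly between [y] and [b]. For
    [y = rho T b < b] the left limit is [h y] itself and the strict inequality fails. *)
Lemma left_limit_gt (R : realType) (T : set R) (h d : R -> R) (b l y : R) :
  closed T -> left_limit T h b l -> T y -> y < b -> y != rho T b ->
  (forall t, T t -> y <= t < b -> is_nabla T h t (d t)) ->
  (forall t, T t -> y < t < b -> 0 < d t) -> h y < l.
Proof.
move=> cT hl Ty yb yr hd d0; have /andP[yS _] := rho_bounds Ty yb.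
have r0 : 0 < rho T b - y by rewrite subr_gt0 lt_neqAle yr.
have [s [Ts _ sb]] := rho_approx Ty yb r0; rewrite subKr => ys.
apply: (@lt_le_trans _ _ (h s)).
  apply: (@nabla_increasing _ T _ d) => // t Tt /andP[yt ts].
    by apply: hd => //; rewrite yt (le_lt_trans ts).
  by apply: d0 => //; rewrite yt (le_lt_trans ts).
apply: (@left_limit_ge _ T _ d b) => // t Tt /andP[st tb].
  by apply: hd => //; rewrite tb (le_trans (ltW ys)).
by rewrite ltW // d0 // tb (lt_trans ys).
Qed.


(** * Increasing quotients when the derivative of [g] is positive *)

(* For [x < y], the slope of [f] against [g] is at most [r x] between [a+] and
   [x] and more than [r x] between [x] and [y]: with [k := r x], the function
   [f - k g] has a nabla derivative of the corresponding sign. *)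
Lemma quotient_right_increasing (R : realType) (T : set R) (a b : R)
    (f g df dg : R -> R) (fa ga : R) : closed T -> T b -> a < b ->
  (forall t, ts_oo T a b t -> is_nabla T f t (df t)) ->
  (forall t, ts_oo T a b t -> is_nabla T g t (dg t)) ->
  (forall t, ts_oo T (sigma T a) b t -> 0 < dg t) ->
  right_limit T f a fa -> right_limit T g a ga ->
  increasing_on (ts_oo T (sigma T a) b) (fun t => df t / dg t) ->
  quotient_defined_on (ts_oo T (sigma T a) b) g ga /\
  increasing_on (ts_oo T (sigma T a) b) (fun x => (f x - fa) / (g x - ga)).
Proof.
move=> cT Tb ab hf hg dg0 lf lg inc.
have /andP[aS _] := sigma_bounds Tb ab.
have inI t x : ts_oo T (sigma T a) b x -> T t -> sigma T a < t <= x ->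
    ts_oo T (sigma T a) b t.
  by move=> [_ /andP[_ xb]] Tt /andP[St tx]; split => //; rewrite St (le_lt_trans tx).
have inO t x : ts_oo T (sigma T a) b x -> T t -> a < t <= x -> ts_oo T a b t.
  by move=> [_ /andP[_ xb]] Tt /andP[St tx]; split => //; rewrite St (le_lt_trans tx).
have gpos x : ts_oo T (sigma T a) b x -> 0 < g x - ga.
  move=> Ix; have [Tx /andP[Sx xb]] := Ix; rewrite subr_gt0.
  apply: (@right_limit_lt _ T _ dg a) => //; first exact: le_lt_trans Sx.
    by move=> t Tt tx; apply: hg; exact: inO Ix Tt tx.
  by move=> t Tt tx; apply: dg0; exact: inI Ix Tt tx.
split=> [x /gpos /lt0r_neq0 //|x y Ix Iy xy].
have [Tx /andP[Sx xb]] := Ix; have [Ty /andP[Sy yb]] := Iy.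
have ax : a < x by exact: le_lt_trans Sx.
pose k := df x / dg x.
have hk t : ts_oo T a b t ->
    is_nabla T (fun x => k * g x - f x) t (k * dg t - df t).
  move=> It.
  have -> : k * dg t - df t = - (df t - k * dg t) by rewrite opprB.
  under eq_fun do rewrite -opprB.
  by apply/is_nablaN/is_nablaBZ; [exact: hf | exact: hg].
(* The derivative of [k * g - f] vanishes at [t = x], so only the weak comparison is used here; the
   strict one comes from ]x,y]. *)
have low : k * ga - fa <= k * g x - f x.
  apply: (@right_limit_le _ T (fun x => k * g x - f x)
    (fun t => k * dg t - df t) a) => //.
  - have -> : k * ga - fa = - (fa - k * ga) by rewrite opprB.
    under eq_fun do rewrite -opprB.
    exact/right_limitN/right_limitBZ.
  - by move=> t Tt tx; apply: hk; exact: inO Ix Tt tx.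
  - move=> t Tt tx; have It := inI _ _ Ix Tt tx.
    rewrite subr_ge0 -ler_pdivrMr ?dg0 // /k.
    have /andP[_] := tx; rewrite le_eqVlt => /predU1P[-> //|tltx].
    by rewrite ltW //; apply: (inc _ _ It Ix tltx).
have xty t : x <= t -> sigma T a < t by exact: lt_le_trans.
have high : k * (g y - g x) < f y - f x.
  suff : f x - k * g x < f y - k * g y by rewrite mulrBr; lra.
  apply: (@nabla_increasing _ T (fun x => f x - k * g x)
    (fun t => df t - k * dg t)) => //.
    move=> t Tt /andP[xt ty].
    have It : ts_oo T a b t by apply: (inO _ _ Iy Tt); rewrite ty (lt_le_trans ax).
    by apply: is_nablaBZ; [exact: hf | exact: hg].
  move=> t Tt /andP[xt ty].
  have It : ts_oo T (sigma T a) b t by apply: (inI _ _ Iy Tt); rewrite ty xty // ltW.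
  by rewrite subr_gt0 -ltr_pdivlMr ?dg0 //; exact: (inc _ _ Ix It xt).
have gxy : 0 < g y - g x.
  rewrite subr_gt0; apply: (@nabla_increasing _ T _ dg) => // t Tt /andP[xt ty].
    by apply: hg; apply: (inO _ _ Iy Tt); rewrite ty (lt_le_trans ax).
  by apply: dg0; apply: (inI _ _ Iy Tt); rewrite ty xty // ltW.
have gx := gpos _ Ix; have gy := gpos _ Iy.
rewrite ltr_pdivrMr // mulrAC ltr_pdivlMr //.
have H1 : (f x - fa) * (g y - g x) <= k * (g x - ga) * (g y - g x).
  by rewrite ler_pM2r // mulrBr; lra.
have H2 : k * (g y - g x) * (g x - ga) < (f y - f x) * (g x - ga).
  by rewrite ltr_pM2r.
(* The cross-multiplied difference of the quotients at [y] and [x] reduces to the comparison of the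
   slopes over the two adjacent intervals, with [k] in between. *)
rewrite -subr_gt0.
have -> : (f y - fa) * (g x - ga) - (f x - fa) * (g y - ga) =
  (f y - f x) * (g x - ga) - (f x - fa) * (g y - g x) by ring.
rewrite subr_gt0; apply: le_lt_trans H1 _.
by rewrite mulrAC.
Qed.

(** The shared point is now [y]: the slope is at most [r y] from [x] to [y], and more than [r y]
    from [y] to the limit at [b]. The latter interval contains points of [T] because [y] is not
    [rho T b]. *)
Lemma quotient_left_increasing (R : realType) (T : set R) (a b : R)
    (f g df dg : R -> R) (fb gb : R) : closed T -> T b -> a < b ->
  (forall t, ts_oo T a b t -> is_nabla T f t (df t)) ->
  (forall t, ts_oo T a b t -> is_nabla T g t (dg t)) ->
  (forall t, ts_oo T (sigma T a) b t -> 0 < dg t) ->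
  left_limit T f b fb -> left_limit T g b gb ->
  increasing_on (ts_oo T (sigma T a) b) (fun t => df t / dg t) ->
  quotient_defined_on (ts_oo T (sigma T a) b `\ rho T b) g gb /\
  increasing_on (ts_oo T (sigma T a) b `\ rho T b)
    (fun x => (f x - fb) / (g x - gb)).
Proof.
move=> cT Tb ab hf hg dg0 lf lg inc.
have /andP[aS _] := sigma_bounds Tb ab.
have inI t x : ts_oo T (sigma T a) b x -> T t -> x <= t < b ->
    ts_oo T (sigma T a) b t.
  by move=> [_ /andP[Sx _]] Tt /andP[xt tb]; split => //; rewrite tb (lt_le_trans Sx).
have inO t x : ts_oo T (sigma T a) b x -> T t -> x <= t < b -> ts_oo T a b t.
  move=> Ix Tt xtb; have [_ /andP[St tb]] := inI _ _ Ix Tt xtb.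
  by split => //; rewrite tb (le_lt_trans aS).
have gpos x : ts_oo T (sigma T a) b x -> x != rho T b -> 0 < gb - g x.
  move=> Ix xr; have [Tx /andP[Sx xb]] := Ix; rewrite subr_gt0.
  apply: (@left_limit_gt _ T _ dg b) => //.
    by move=> t Tt tx; apply: hg; exact: inO Ix Tt tx.
  move=> t Tt /andP[xt tb]; apply: dg0; apply: (inI _ _ Ix Tt).
  by rewrite tb ltW.
split=> [x [Ix /eqP xr]|x y [Ix /eqP xr] [Iy /eqP yr] xy].
  by rewrite -oppr_eq0 opprB lt0r_neq0 // gpos.
have [Tx /andP[Sx xb]] := Ix; have [Ty /andP[Sy yb]] := Iy.
pose k := df y / dg y.
have high : k * (gb - g y) < fb - f y.
  suff : f y - k * g y < fb - k * gb by rewrite mulrBr; lra.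
  apply: (@left_limit_gt _ T (fun x => f x - k * g x)
    (fun t => df t - k * dg t) b) => //.
  - exact: left_limitBZ.
  - move=> t Tt ty; have It := inO _ _ Iy Tt ty.
    by apply: is_nablaBZ; [exact: hf | exact: hg].
  - move=> t Tt /andP[yt tb].
    have It : ts_oo T (sigma T a) b t by apply: (inI _ _ Iy Tt); rewrite tb ltW.
    by rewrite subr_gt0 -ltr_pdivlMr ?dg0 //; exact: (inc _ _ Iy It yt).
have low : f y - f x <= k * (g y - g x).
  suff : k * g x - f x <= k * g y - f y by rewrite mulrBr; lra.
  apply: (@nabla_nondecreasing _ T (fun x => k * g x - f x)
    (fun t => k * dg t - df t)) => //; first exact: ltW.
    move=> t Tt /andP[xt ty].
    have It : ts_oo T a b t by apply: (inO _ _ Ix Tt); rewrite xt (le_lt_trans ty).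
    have -> : k * dg t - df t = - (df t - k * dg t) by rewrite opprB.
    under eq_fun do rewrite -opprB.
    by apply/is_nablaN/is_nablaBZ; [exact: hf | exact: hg].
  move=> t Tt /andP[xt ty].
  have It : ts_oo T (sigma T a) b t.
    by apply: (inI _ _ Ix Tt); rewrite ltW // (le_lt_trans ty).
  rewrite subr_ge0 -ler_pdivrMr ?dg0 // /k.
  move: ty; rewrite le_eqVlt => /predU1P[-> //|tlty].
  by rewrite ltW //; apply: (inc _ _ It Iy tlty).
have gxy : 0 < g y - g x.
  rewrite subr_gt0; apply: (@nabla_increasing _ T _ dg) => // t Tt /andP[xt ty].
    by apply: hg; apply: (inO _ _ Ix Tt); rewrite xt (le_lt_trans ty).
  by apply: dg0; apply: (inI _ _ Ix Tt); rewrite ltW // (le_lt_trans ty).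
have gx := gpos _ Ix xr; have gy := gpos _ Iy yr.
(* Both signs are changed so that the denominators become positive. *)
have qE z : (f z - fb) / (g z - gb) = (fb - f z) / (gb - g z).
  by rewrite -[f z - fb]opprB -[g z - gb]opprB invrN mulrNN.
rewrite !qE ltr_pdivrMr // mulrAC ltr_pdivlMr //.
have H1 : (f y - f x) * (gb - g y) <= k * (g y - g x) * (gb - g y).
  by rewrite ler_pM2r.
have H2 : k * (gb - g y) * (g y - g x) < (fb - f y) * (g y - g x).
  by rewrite ltr_pM2r.
rewrite -subr_gt0.
have -> : (fb - f y) * (gb - g x) - (fb - f x) * (gb - g y) =
  (fb - f y) * (g y - g x) - (f y - f x) * (gb - g y) by ring.
rewrite subr_gt0; apply: le_lt_trans H1 _.
by rewrite mulrAC.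
Qed.

(** * Reduction of the other sign cases, and the theorem *)

Lemma increasing_onN (R : realType) (D : set R) (h k : R -> R) :
  (forall x, k x = - h x) -> increasing_on D k <-> decreasing_on D h.
Proof.
by move=> kE; split=> H x y Dx Dy xy; have := H x y Dx Dy xy; rewrite !kE ltrN2.
Qed.

(** Negating [f] exchanges increasing and decreasing; negating [f] and [g] together reverses the
    sign of [dg] and preserves both ratios. Abstracting [lim] lets both endpoints share the
    argument, and [E] is separate from [D] because [rho T b] is removed at the right endpoint. *)
Lemma quotient_monotone_sign (R : realType) (T D E : set R) (a b : R)
    (lim : (R -> R) -> R -> Prop) :
  (forall h l, lim h l -> lim (fun x => - h x) (- l)) ->
  (forall (f g df dg : R -> R) (fl gl : R),
    (forall t, ts_oo T a b t -> is_nabla T f t (df t)) ->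
    (forall t, ts_oo T a b t -> is_nabla T g t (dg t)) ->
    (forall t, D t -> 0 < dg t) -> lim f fl -> lim g gl ->
    increasing_on D (fun t => df t / dg t) ->
    quotient_defined_on E g gl /\
    increasing_on E (fun x => (f x - fl) / (g x - gl))) ->
  forall (f g df dg : R -> R) (fl gl : R),
  (forall t, ts_oo T a b t -> is_nabla T f t (df t)) ->
  (forall t, ts_oo T a b t -> is_nabla T g t (dg t)) ->
  (forall t, D t -> 0 < dg t) \/ (forall t, D t -> dg t < 0) ->
  lim f fl -> lim g gl ->
  let r := fun t => df t / dg t in
  let q := fun x => (f x - fl) / (g x - gl) in
  (increasing_on D r -> quotient_defined_on E g gl /\ increasing_on E q) /\
  (decreasing_on D r -> quotient_defined_on E g gl /\ decreasing_on E q).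
Proof.
move=> limN core.
have pos (f g df dg : R -> R) (fl gl : R) :
    (forall t, ts_oo T a b t -> is_nabla T f t (df t)) ->
    (forall t, ts_oo T a b t -> is_nabla T g t (dg t)) ->
    (forall t, D t -> 0 < dg t) -> lim f fl -> lim g gl ->
    let r := fun t => df t / dg t in
    let q := fun x => (f x - fl) / (g x - gl) in
    (increasing_on D r -> quotient_defined_on E g gl /\ increasing_on E q) /\
    (decreasing_on D r -> quotient_defined_on E g gl /\ decreasing_on E q).
  move=> hf hg dg0 lf lg r q; split; first exact: core.
  move=> dec.
  have [||] := core (fun x => - f x) g (fun t => - df t) dg (- fl) gl _ hg dg0
    (limN _ _ lf) lg.
  - by move=> t It; exact/is_nablaN/hf.
  - by apply/(@increasing_onN _ _ r _ _).2 => // t; rewrite mulNr.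
  move=> gdef inc; split=> //.
  by apply: (@increasing_onN _ _ q _ _).1 inc => x; rewrite /q -mulNr opprD.
move=> f g df dg fl gl hf hg [dg0|dg0] lf lg; first exact: pos.
have := pos (fun x => - f x) (fun x => - g x) (fun t => - df t)
  (fun t => - dg t) (- fl) (- gl).
have divNN (x y : R) : - x / - y = x / y by rewrite invrN mulrNN.
have -> : (fun t => - df t / - dg t) = (fun t => df t / dg t).
  by apply/funext => t.
have -> : (fun x => (- f x - - fl) / (- g x - - gl)) =
    (fun x => (f x - fl) / (g x - gl)).
  by apply/funext => x; rewrite -!opprD.
have -> : quotient_defined_on E (fun x => - g x) (- gl) =
    quotient_defined_on E g gl.
  apply/propext; split=> H x /H; first by rewrite -opprD oppr_eq0.
  by rewrite -opprD oppr_eq0.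
apply.
- by move=> t It; exact/is_nablaN/hf.
- by move=> t It; exact/is_nablaN/hg.
- by move=> t /dg0; rewrite oppr_gt0.
- exact: limN.
- exact: limN.
Qed.

(* In the second part the point [rho T b] is removed because f(b^-) and g(b^-)
   are the values there when [b] is left-scattered, so the quotient is 0/0.
   When [b] is left-dense, [rho T b = b] and nothing is removed. *)
Theorem theorem2p5 (R : realType) (T : set R) (hT : time_scale T) (a b : R)
    (Ta : T a) (Tb : T b) (hab : a < b) (f g : R -> R)
    (hf : forall t, ts_oo T a b t -> nabla_differentiable T f t)
    (hg : forall t, ts_oo T a b t -> nabla_differentiable T g t)
    (hg_sign : (forall t, ts_oo T (sigma T a) b t -> 0 < nabla T g t) \/
               (forall t, ts_oo T (sigma T a) b t -> nabla T g t < 0)) :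
  let I := ts_oo T (sigma T a) b in
  let r := fun t => nabla T f t / nabla T g t in
  (forall fa ga : R, right_limit T f a fa -> right_limit T g a ga ->
     let q := fun x => (f x - fa) / (g x - ga) in
     (increasing_on I r ->
        quotient_defined_on I g ga /\ increasing_on I q) /\
     (decreasing_on I r ->
        quotient_defined_on I g ga /\ decreasing_on I q)) /\
  (forall fb gb : R, left_limit T f b fb -> left_limit T g b gb ->
     let q := fun x => (f x - fb) / (g x - gb) in
     let J := I `\ rho T b in
     (increasing_on I r ->
        quotient_defined_on J g gb /\ increasing_on J q) /\
     (decreasing_on I r ->
        quotient_defined_on J g gb /\ decreasing_on J q)).
Proof.
move=> I r; have [_ cT] := hT.
(* Differentiability makes the set of derivatives nonempty, so [xget] returns one of them and not
   the default 0. *)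
have nabla_is (h : R -> R) (hh : forall t, ts_oo T a b t -> nabla_differentiable T h t) t :
    ts_oo T a b t -> is_nabla T h t (nabla T h t).
  by move=> /hh [d hd]; rewrite /nabla; case: xgetP => [_ -> //|/(_ d)].
split=> [fa ga|fb gb] lf lg.
  apply: (quotient_monotone_sign (T := T) (a := a) (b := b)
    (lim := fun h l => right_limit T h a l)) => //.
  - by move=> h l; exact: right_limitN.
  - by move=> *; apply: (quotient_right_increasing (a := a) (b := b)); eassumption.
  - exact: nabla_is.
  - exact: nabla_is.
apply: (quotient_monotone_sign (T := T) (a := a) (b := b) (D := I)
  (lim := fun h l => left_limit T h b l)) => //.
- by move=> h l; exact: left_limitN.
- by move=> *; apply: (quotient_left_increasing (a := a) (b := b)); eassumption.
- exact: nabla_is.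
- exact: nabla_is.
Qed.
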